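(* Let $0<\theta<1/110$, let $c>0$, and let $\alpha>0$. For each $N$, let $p=p(N)\in(cN^{-\theta},1]$ and let $W$ be a random subset of $\mathbb{Z}_N$ in which the events $x\in W$, $x\in\mathbb{Z}_N$, are independent and each has probability $p$. Identify $\mathbb{Z}_N$ with $\{0,1,\dots,N-1\}$. Then the probability that the statement ''for every set $A\subset W$ with $|A|\geq \alpha|W|$ there are $x,y\in A$ such that $x-y$ is a non-zero perfect square'' holds is $1-o_\alpha(1)$ as $N\to\infty$.
   Context: Here $o_\alpha(1)$ denotes a quantity tending to $0$ as $N\to\infty$, at a rate that may depend on $\alpha$. The difference $x-y$ is taken as an integer difference of the representatives in $\{0,\dots,N-1\}$. *)

(* Defs.v *)
From HB Require Import structures.
From mathcomp Require Import all_boot all_order all_algebra.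
From mathcomp Require Import all_classical all_reals all_analysis.

Set Implicit Arguments.
Unset Strict Implicit.
Unset Printing Implicit Defensive.

Import Order.TTheory GRing.Theory Num.Theory.
Import numFieldNormedType.Exports.

Local Open Scope classical_set_scope.
Local Open Scope ring_scope.

Definition mutually_independent (R : realType) (d : measure_display)
    (Omega : measurableType d) (P : probability Omega R)
    (I : finType) (E : I -> set Omega) : Prop :=
  forall J : {set I},
    P (\bigcap_(i in [set` J]) E i) = (\prod_(i in J) P (E i))%E.

Definition mem_event (Omega : Type) (T : finType) (W : Omega -> {set T})
    (x : T) : set Omega :=
  [set w | x \in W w].

Definition binomial_random_set (R : realType) (d : measure_display)
    (Omega : measurableType d) (P : probability Omega R)
    (T : finType) (p : R) (W : Omega -> {set T}) : Prop :=
  [/\ forall x, measurable (mem_event W x),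
      forall x, P (mem_event W x) = p%:E
    & mutually_independent P (mem_event W)].

Definition nonzero_perfect_square (z : int) : Prop :=
  z != 0 /\ exists k : int, z = k ^+ 2.

(* 'I_N stands for Z_N with its representatives 0, ..., N-1; x%:Z - y%:Z is
   the integer difference of the representatives, not a residue mod N. *)
Definition has_square_difference (N : nat) (A : {set 'I_N}) : Prop :=
  exists x y : 'I_N,
    [/\ x \in A, y \in A & nonzero_perfect_square (x%:Z - y%:Z)].

Definition relatively_sarkozy (R : realType) (alpha : R) (N : nat)
    (W : {set 'I_N}) : Prop :=
  forall A : {set 'I_N}, A \subset W ->
    alpha * #|W|%:R <= #|A|%:R -> has_square_difference A.

(* Main.v *)
Require Import Defs.
From HB Require Import structures.
From mathcomp Require Import all_boot all_order all_algebra.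
From mathcomp Require Import all_classical all_reals all_analysis.
From mathcomp Require Import ring lra zify.

(* A set without square differences is an independent set of the graph on
   {0, ..., N-1} joining the points whose difference is a non-zero square.

   Dense sets have a square return: for f the indicator of a dense set in a
   finite abelian group and P the Fejer average of f along a progression of
   step D, van der Corput's inequality shows that if f has no correlation along
   squares then f - P f correlates with a progression of step D' = 2 D^2 J!, so
   that the average along step D' (at a much shorter scale) has larger L^2 norm
   by a fixed amount. As the norm is at most 1, this can only be iterated a
   bounded number of times.

   Applied in Z_(2N) with generator q^2 and averaged over q, this shows that
   every dense set of integers below N contains a vertex of degree >> sqrt N in
   the induced graph. By the Kleitman-Winston branching argument the independent
   sets, weighted by lam^|I| with lam = e p, then have total weight at most
   exp (small constant * p N) whenever p sqrt N is large. A first moment bound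
   finishes the proof, |W| >= p N / 2 being true with high probability by
   Chebyshev. *)

Set Implicit Arguments.
Unset Strict Implicit.
Unset Printing Implicit Defensive.

Import Order.TTheory GRing.Theory Num.Theory.
Import numFieldNormedType.Exports.

Local Open Scope ring_scope.

(** * Averages along progressions *)

Section Averages.
Variable R : realType.
Implicit Types (F : nat -> R) (K L : nat).

Definition avg K F : R := (\sum_(k < K) F k) / K%:R.

Lemma eq_avg K F1 F2 : (forall k, (k < K)%N -> F1 k = F2 k) ->
  avg K F1 = avg K F2.
Proof. by move=> e; rewrite /avg; congr (_ / _); apply: eq_bigr => i _; exact: e. Qed.

Lemma avgD K F1 F2 : avg K (fun k => F1 k + F2 k) = avg K F1 + avg K F2.
Proof. by rewrite /avg big_split /= mulrDl. Qed.

Lemma avgZ K c F : avg K (fun k => c * F k) = c * avg K F.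
Proof. by rewrite /avg -mulr_sumr mulrA. Qed.

Lemma avgB K F1 F2 : avg K (fun k => F1 k - F2 k) = avg K F1 - avg K F2.
Proof. by rewrite /avg sumrB mulrBl. Qed.

Lemma avg_cst K c : (0 < K)%N -> avg K (fun=> c) = c.
Proof.
by move=> K0; rewrite /avg sumr_const card_ord -[c *+ _]mulr_natr mulfK // pnatr_eq0 -lt0n.
Qed.

Lemma le_avg K F1 F2 : (forall k, (k < K)%N -> F1 k <= F2 k) ->
  avg K F1 <= avg K F2.
Proof.
move=> le; rewrite /avg ler_wpM2r ?invr_ge0 ?ler0n //.
by apply: ler_sum => i _; exact: le.
Qed.

Lemma ler_norm_avg K F c : 0 <= c -> (forall k, (k < K)%N -> `|F k| <= c) ->
  `|avg K F| <= c.
Proof.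
move=> c0 le; have [->|K0] := posnP K; first by rewrite /avg big_ord0 mul0r normr0.
rewrite ler_norml -{1}(avg_cst (- c) K0) -{2}(avg_cst c K0).
by apply/andP; split; apply: le_avg => k /le; rewrite ler_norml => /andP[].
Qed.

Lemma exchange_avg K L (F : nat -> nat -> R) :
  avg K (fun k => avg L (F k)) = avg L (fun l => avg K (F ^~ l)).
Proof.
rewrite /avg -!mulr_suml exchange_big /= -!mulrA; congr (_ * _); exact: mulrC.
Qed.

Lemma avg_sqr_le K F : avg K F ^+ 2 <= avg K (fun k => F k ^+ 2).
Proof.
have [->|K0] := posnP K; first by rewrite /avg !big_ord0 mul0r expr0n.
set m := avg K F.
have : avg K (fun=> 0) <= avg K (fun k => F k ^+ 2 - 2 * m * F k + m ^+ 2).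
  apply: le_avg => k _; have -> : F k ^+ 2 - 2 * m * F k + m ^+ 2 = (F k - m) ^+ 2 by ring.
  exact: sqr_ge0.
rewrite avgD avgB avgZ !avg_cst // -/m; lra.
Qed.

(** Each shift by one trades one boundary term of the sum for another and costs at most 2 in the
    numerator. *)
Lemma avg_shift K F j : (forall k, `|F k| <= 1) ->
  `|avg K (fun k => F (k + j)%N) - avg K F| <= 2 * j%:R / K%:R.
Proof.
move=> F1; rewrite /avg -mulrBl normrM normfV normr_nat.
rewrite ler_wpM2r ?invr_ge0 ?ler0n //.
elim: j => [|j IH].
  under eq_bigr do rewrite addn0.
  by rewrite subrr normr0 mulr0.
have step : \sum_(k < K) F (k + j.+1)%N - \sum_(k < K) F (k + j)%N = F (K + j)%N - F j.
  elim: K {IH} => [|K IH]; first by rewrite !big_ord0 add0n !subrr.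
  rewrite !big_ord_recr /= !addSnnS.
  rewrite opprD addrACA IH; ring.
rewrite -(subrKA (\sum_(k < K) F (k + j)%N)) step.
apply: (le_trans (ler_normD _ _)); rewrite -[j.+1%:R]natr1 mulrDr mulr1 addrC.
apply: lerD; first exact: IH.
apply: (le_trans (ler_normB _ _)).
by have := F1 (K + j)%N; have := F1 j; lra.
Qed.

Lemma avg_diag J : (0 < J)%N ->
  avg J (fun i => avg J (fun j => (i == j)%:R)) = J%:R^-1.
Proof.
move=> J0; rewrite (@eq_avg _ _ (fun=> J%:R^-1)) ?avg_cst // => i iJ.
rewrite /avg (bigD1 (Ordinal iJ)) //= eqxx big1 ?addr0 ?mul1r // => j.
by rewrite -val_eqE /= eq_sym => /negPf ->.
Qed.

End Averages.

(** * Means over a finite abelian group *)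

Section Mean.
Variables (R : realType) (G : finZmodType).
Implicit Types (f g : G -> R).

Definition mean f : R := (\sum_x f x) / #|G|%:R.

Lemma cardG_gt0 : 0 < #|G|%:R :> R.
Proof. by rewrite ltr0n; apply/card_gt0P; exists 0. Qed.

Lemma eq_mean f g : f =1 g -> mean f = mean g.
Proof. by move=> e; rewrite /mean; congr (_ / _); apply: eq_bigr => i _; exact: e. Qed.

Lemma meanD f g : mean (fun x => f x + g x) = mean f + mean g.
Proof. by rewrite /mean big_split /= mulrDl. Qed.

Lemma meanB f g : mean (fun x => f x - g x) = mean f - mean g.
Proof. by rewrite /mean sumrB mulrBl. Qed.

Lemma meanZ c f : mean (fun x => c * f x) = c * mean f.
Proof. by rewrite /mean -mulr_sumr mulrA. Qed.

Lemma mean_cst c : mean (fun=> c) = c.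
Proof.
rewrite /mean sumr_const -[c *+ _]mulr_natr mulfK //; exact: lt0r_neq0 cardG_gt0.
Qed.

Lemma le_mean f g : (forall x, f x <= g x) -> mean f <= mean g.
Proof.
move=> le; rewrite /mean ler_wpM2r ?invr_ge0 ?ler0n //.
by apply: ler_sum => i _; exact: le.
Qed.

Lemma mean_translate f a : mean (fun x => f (x + a)) = mean f.
Proof.
rewrite /mean; congr (_ / _); rewrite [RHS](reindex_inj (addIr a)) //.
Qed.

Lemma mean_avg K (F : nat -> G -> R) :
  mean (fun x => avg K (F ^~ x)) = avg K (fun k => mean (F k)).
Proof.
rewrite /mean /avg -!mulr_suml exchange_big /= -!mulrA; congr (_ * _); exact: mulrC.
Qed.

End Mean.

(** * Averaging operators along progressions in the group *)

Section ProgressionAverages.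
Variables (R : realType) (G : finZmodType) (t : G).
Implicit Types (f g : G -> R) (D a : int) (L K : nat).

Definition apavg D L f : G -> R := fun x => avg L (fun l => f (x + t *~ (D * l%:Z))).

(* [apavg (- D) L] is the adjoint of [apavg D L] (see [apavg_adj]), so that
   [fejer D L] is self-adjoint and positive. *)
Definition fejer D L f : G -> R := apavg D L (apavg (- D) L f).

Lemma apavgB D L f g : apavg D L (fun x => f x - g x) =1 (fun x => apavg D L f x - apavg D L g x).
Proof. by move=> x; exact: avgB. Qed.

Lemma norm_apavg D L f c : 0 <= c -> (forall x, `|f x| <= c) ->
  forall x, `|apavg D L f x| <= c.
Proof. by move=> c0 fc x; apply: ler_norm_avg => // k _. Qed.

Lemma norm_fejer D L f c : 0 <= c -> (forall x, `|f x| <= c) ->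
  forall x, `|fejer D L f x| <= c.
Proof. by move=> c0 fc; do 2!apply: norm_apavg => //. Qed.

Lemma mean_apavg D L f : (0 < L)%N -> mean (apavg D L f) = mean f.
Proof.
move=> L0; rewrite (mean_avg L (fun l x => f (x + t *~ (D * l%:Z)))).
rewrite -[RHS](avg_cst _ L0); apply: eq_avg => k _; exact: mean_translate.
Qed.

Lemma apavg_adj D L f g :
  mean (fun x => apavg D L f x * g x) = mean (fun x => f x * apavg (- D) L g x).
Proof.
rewrite (@eq_mean _ _ _ (fun x => avg L (fun l => g x * f (x + t *~ (D * l%:Z))))); last first.
  by move=> x; rewrite avgZ mulrC.
rewrite (@eq_mean _ _ (fun x => f x * _) (fun x => avg L (fun l => f x * g (x + t *~ (- D * l%:Z))))); last first.
  by move=> x; rewrite avgZ.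
rewrite (mean_avg L (fun l x => g x * f (x + t *~ (D * l%:Z)))).
rewrite (mean_avg L (fun l x => f x * g (x + t *~ (- D * l%:Z)))).
apply: eq_avg => l _.
rewrite -[LHS](mean_translate _ (t *~ (- D * l%:Z))); apply: eq_mean => x.
by rewrite mulNr mulrNz subrK mulrC.
Qed.

Lemma fejer_adj D L f g :
  mean (fun x => fejer D L f x * g x) = mean (fun x => f x * fejer D L g x).
Proof. by rewrite apavg_adj apavg_adj opprK. Qed.

Lemma apavgC D L D' L' f : apavg D L (apavg D' L' f) =1 apavg D' L' (apavg D L f).
Proof.
move=> x; rewrite /apavg exchange_avg; apply: eq_avg => l _; apply: eq_avg => k _.
by rewrite addrAC.
Qed.

Lemma eq_apavg D L f g : f =1 g -> apavg D L f =1 apavg D L g.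
Proof. by move=> e x; apply: eq_avg => l _. Qed.

Lemma fejer_apavgC D L D' L' f :
  fejer D L (apavg D' L' f) =1 apavg D' L' (fejer D L f).
Proof.
move=> x; rewrite /fejer [RHS]apavgC; apply: eq_apavg => y; exact: apavgC.
Qed.

Lemma fejerB D L f g : fejer D L (fun x => f x - g x) =1 (fun x => fejer D L f x - fejer D L g x).
Proof. by move=> x; rewrite /fejer -apavgB; apply: eq_apavg => y; exact: (apavgB (- D)). Qed.

Lemma mean_apavg_sqr D L f : (0 < L)%N ->
  mean (fun x => apavg D L f x ^+ 2) <= mean (fun x => f x ^+ 2).
Proof.
move=> L0; rewrite -[leRHS](mean_apavg D _ L0); apply: le_mean => x; exact: avg_sqr_le.
Qed.

Lemma apavg_translate a K f j x : (forall x, `|f x| <= 1) ->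
  `|apavg a K f (x + t *~ (a * j%:Z)) - apavg a K f x| <= 2 * j%:R / K%:R.
Proof.
move=> f1.
have := @avg_shift R K (fun k => f (x + t *~ (a * k%:Z))) j (fun=> f1 _).
congr (`| _ - _ | <= _); apply: eq_avg => k _.
by rewrite -addrA -mulrzDr -mulrDr PoszD [_ + j%:Z]addrC.
Qed.

Lemma apavg_near a L g e : (0 < L)%N -> 0 <= e ->
  (forall x l, (l < L)%N -> `|g (x + t *~ (a * l%:Z)) - g x| <= e) ->
  forall x, `|apavg a L g x - g x| <= e.
Proof.
move=> L0 e0 ge x; rewrite -[g x](avg_cst _ L0) -avgB.
by apply: ler_norm_avg => // l; exact: ge.
Qed.

(** Translating by [a * m * l] shifts a progression of step [a] by [m * l] terms, which is
    negligible when [m * L] is small against [K]. Each of the two layers of [fejer] costs at most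
    [2 * (m * L) / K]. *)
Lemma fejer_apavg_near a (m : nat) K L f : (0 < L)%N -> (forall x, `|f x| <= 1) ->
  forall x, `|fejer (a * m%:Z) L (apavg a K f) x - apavg a K f x|
    <= 4 * (m * L)%:R / K%:R.
Proof.
move=> L0 f1 x; set g := apavg a K f.
pose e : R := 2 * (m * L)%:R / K%:R.
have e0 : 0 <= e by rewrite divr_ge0 ?mulr_ge0 ?ler0n.
have gp y l : (l < L)%N -> `|g (y + t *~ (a * m%:Z * l%:Z)) - g y| <= e.
  move=> lL; rewrite -mulrA -PoszM; apply: (le_trans (apavg_translate _ _ _ _ _)) => //.
  by rewrite ler_wpM2r ?invr_ge0 ?ler0n // ler_wpM2l // ler_nat leq_mul2l ltnW ?orbT.
have gm y l : (l < L)%N -> `|g (y + t *~ (- (a * m%:Z) * l%:Z)) - g y| <= e.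
  move=> lL; rewrite distrC; have := gp (y + t *~ (- (a * m%:Z) * l%:Z)) l lL.
  by rewrite mulNr mulrNz subrK.
rewrite /fejer.
have := apavg_near L0 e0 gp x.
have : `|apavg (a * m%:Z) L (fun y => apavg (- (a * m%:Z)) L g y - g y) x| <= e.
  by apply: norm_apavg => // y; exact: apavg_near.
rewrite apavgB => h1 h2.
rewrite -(subrKA (apavg (a * m%:Z) L g x)); apply: (le_trans (ler_normD _ _)).
apply: (le_trans (lerD h1 h2)); rewrite /e; lra.
Qed.

(** Write P = T T* with T = [apavg D L]. Then <Pf, f> is the squared norm of T* f, and T contracts
    the L2 norm. *)
Lemma fejer_comp_ge0 D L f : (0 < L)%N ->
  0 <= mean (fun x => fejer D L f x * (f x - fejer D L f x)).
Proof.
move=> L0; rewrite (@eq_mean _ _ _ (fun x => fejer D L f x * f x - fejer D L f x ^+ 2)); last first.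
  by move=> x; rewrite mulrBr expr2.
rewrite meanB apavg_adj.
rewrite (_ : mean (fun x => _ * _) = mean (fun x => apavg (- D) L f x ^+ 2)) //.
by rewrite subr_ge0; exact: mean_apavg_sqr.
Qed.

(** <f, Pf> is the squared norm of T* f, whose mean is that of [f]; the parabola [y ^ 2] lies above
    its tangent at [d]. *)
Lemma mean_fejer_ge D L f d : (0 < L)%N -> 0 <= d -> d <= mean f ->
  d ^+ 2 <= mean (fun x => f x * fejer D L f x).
Proof.
move=> L0 d0 df.
rewrite (@eq_mean _ _ _ (fun x => fejer D L f x * f x)); last by move=> x; rewrite mulrC.
rewrite apavg_adj.
have : mean (fun x => 2 * d * apavg (- D) L f x - d ^+ 2) <= mean (fun x => apavg (- D) L f x * apavg (- D) L f x).
  apply: le_mean => x; rewrite -subr_ge0.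
  set y := apavg _ _ _ _.
  have -> : y * y - (2 * d * y - d ^+ 2) = (y - d) ^+ 2 by ring.
  exact: sqr_ge0.
rewrite meanB meanZ mean_cst mean_apavg //; nra.
Qed.

End ProgressionAverages.

(** * The van der Corput inequality for squares *)

Section VanDerCorput.
Variables (R : realType) (G : finZmodType) (t : G).
Implicit Types (f g h : G -> R) (D J K L : nat).

(** The difference of the two squares is [a * k + c], linear in [k], so [h] is correlated with its
    own average along step [a]. Applying [fejer] with a step that is a multiple of [a] hardly
    changes that average and commutes with it, so the small norm of [fejer h] carries over. *)
Lemma mean_corr_squares D K L i j m h (beta : R) :
  (0 < K)%N -> (0 < L)%N -> (forall x, `|h x| <= 1) -> 0 < beta -> (j < i)%N ->
  mean (fun x => fejer t (2 * D ^ 2 * ((i - j) * m))%N%:Z L h x ^+ 2) <= beta ^+ 2 ->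
  avg K (fun k => mean (fun x =>
    h (x + t *~ ((D * (k + i).+1) ^ 2)%N%:Z) * h (x + t *~ ((D * (k + j).+1) ^ 2)%N%:Z)))
  <= beta + 4 * (m * L)%:R / K%:R.
Proof.
move=> K0 L0 h1 beta0 ji hsmall.
pose a := (2 * D ^ 2 * (i - j))%N.
pose c := (D ^ 2 * (i - j) * (2 + i + j))%N.
rewrite (@eq_avg _ _ _ (fun k => mean (fun x => h (x + t *~ c%:Z + t *~ (a%:Z * k%:Z)) * h x))); last first.
  move=> k _; rewrite -[LHS](mean_translate _ (- (t *~ ((D * (k + j).+1) ^ 2)%N%:Z))).
  apply: eq_mean => x; rewrite subrK -!addrA -mulrNz -!mulrzDr; congr (h (x + t *~ _) * _).
  rewrite /a /c -(subnK (ltnW ji)) addnK; move: (i - j)%N => n.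
  have -> : ((D * (k + (n + j)).+1) ^ 2 = D ^ 2 * n * (2 + (n + j) + j) + 2 * D ^ 2 * n * k + (D * (k + j).+1) ^ 2)%N.
    nia.
  by rewrite !PoszD -PoszM [LHS]addrC addrK.
rewrite -(mean_avg K (fun k x => h (x + t *~ c%:Z + t *~ (a%:Z * k%:Z)) * h x)).
set e := _ / _.
pose g := fejer t (2 * D ^ 2 * ((i - j) * m))%N%:Z L h.
(* Cauchy-Schwarz in the form 2 z X <= X^2 / beta + beta z^2, the weight [beta] being the bound on
   the norm of X. *)
apply: (@le_trans _ _ (mean (fun x => (beta ^-1 * apavg t a K g (x + t *~ c%:Z) ^+ 2 + beta) / 2 + e))).
  apply: le_mean => x.
  rewrite (@eq_avg _ _ _ (fun k => h x * h (x + t *~ c%:Z + t *~ (a%:Z * k%:Z)))); last by move=> k _; rewrite mulrC.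
  rewrite avgZ -/(apavg t a K h _); set y := x + _.
  have := @fejer_apavg_near R G t a m K L h L0 h1 y.
  rewrite -PoszM /a -mulnA -/a fejer_apavgC -/g -/e.
  have := h1 x; move: (apavg _ _ _ g y) (apavg _ _ _ h y) (h x) => X Y z.
  rewrite !ler_norml => /andP[z1 z2] /andP[d1 d2].
  have e0 : z * Y <= z * X + e by nra.
  apply: (le_trans e0); rewrite lerD2r.
  have : 0 <= beta^-1 * (X - beta * z) ^+ 2 by rewrite mulr_ge0 ?sqr_ge0 // invr_ge0 ltW.
  have -> : beta^-1 * (X - beta * z) ^+ 2 = beta^-1 * X ^+ 2 - 2 * z * X + beta * z ^+ 2.
    by field; exact: lt0r_neq0.
  have zz : z ^+ 2 <= 1 by nra.
  have : beta * z ^+ 2 <= beta by rewrite ler_piMr // ltW.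
  by move=> ? ?; lra.
rewrite meanD mean_cst lerD2r.
rewrite (@eq_mean _ _ _ (fun x => (beta^-1 / 2) * apavg t a K g (x + t *~ c%:Z) ^+ 2 + beta / 2)); last first.
  by move=> x; ring.
rewrite meanD mean_cst meanZ (mean_translate (fun x => apavg t a K g x ^+ 2)).
have := le_trans (mean_apavg_sqr t a g K0) hsmall.
set X := mean _ => hX.
have : beta^-1 * X <= beta.
  by rewrite mulrC ler_pdivrMr // -expr2.
by lra.
Qed.

(* The squares are [(D * k.+1) ^ 2] because the exponent 0 must be avoided: it
   returns trivially. *)
Lemma van_der_corput_squares D J K L h (beta : R) :
  (0 < J)%N -> (0 < K)%N -> (0 < L)%N -> (forall x, `|h x| <= 1) -> 0 < beta ->
  mean (fun x => fejer t (2 * D ^ 2 * J`!)%N%:Z L h x ^+ 2) <= beta ^+ 2 ->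
  mean (fun x => avg K (fun k => h (x + t *~ ((D * k.+1) ^ 2)%N%:Z)) ^+ 2)
  <= 4 * J%:R / K%:R + J%:R^-1 + (beta + 4 * (J`! * L)%:R / K%:R).
Proof.
move=> J0 K0 L0 h1 beta0 hsmall.
pose u k x := h (x + t *~ ((D * k.+1) ^ 2)%N%:Z).
pose V x := avg K (u ^~ x).
(* Van der Corput's device: average over windows of [J] consecutive terms before squaring, at a cost
   of order [J / K]. *)
pose w x k := avg J (fun j => u (k + j)%N x).
pose V' x := avg K (w x).
set gamma := beta + _.
have gamma0 : 0 <= gamma by rewrite addr_ge0 ?ltW // divr_gt0 ?mulr_gt0 ?ltr0n ?muln_gt0 ?fact_gt0.
have u1 k x : `|u k x| <= 1 by exact: h1.
have V1 x : `|V x| <= 1 by exact: ler_norm_avg.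
have V'1 x : `|V' x| <= 1 by apply: ler_norm_avg => // k _; exact: ler_norm_avg.
have VV' x : `|V' x - V x| <= 2 * J%:R / K%:R.
  rewrite /V' /w exchange_avg -[V x](avg_cst _ J0) -avgB.
  apply: ler_norm_avg; first by rewrite divr_ge0 ?mulr_ge0 ?ler0n.
  move=> j jJ; apply: (le_trans (avg_shift _ _ _)) => //.
  by rewrite ler_wpM2r ?invr_ge0 ?ler0n // ler_wpM2l // ler_nat ltnW.
have VV'2 x : V x ^+ 2 <= 4 * J%:R / K%:R + V' x ^+ 2.
  have := V1 x; have := V'1 x; have := VV' x.
  rewrite -!mulrA; set e := J%:R / K%:R.
  by rewrite !ler_norml => /andP[? ?] /andP[? ?] /andP[? ?]; nra.
apply: (le_trans (le_mean VV'2)); rewrite meanD mean_cst -addrA lerD2l.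
have V'w x : V' x ^+ 2 <= avg K (fun k => avg J (fun i => avg J (fun j => u (k + i)%N x * u (k + j)%N x))).
  apply: (le_trans (avg_sqr_le _ _)); apply: le_avg => k _.
  rewrite expr2 /w -avgZ le_eqVlt; apply/orP; left; apply/eqP; apply: eq_avg => i _.
  by rewrite mulrC -avgZ.
apply: (le_trans (le_mean V'w)).
rewrite (mean_avg K (fun k x => avg J (fun i => avg J (fun j => u (k + i)%N x * u (k + j)%N x)))).
rewrite (@eq_avg _ _ _ (fun k => avg J (fun i => avg J (fun j => mean (fun x => u (k + i)%N x * u (k + j)%N x))))); last first.
  move=> k _; rewrite (mean_avg J (fun i x => avg J (fun j => u (k + i)%N x * u (k + j)%N x))).
  by apply: eq_avg => i _; rewrite (mean_avg J (fun j x => u (k + i)%N x * u (k + j)%N x)).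
rewrite exchange_avg.
(* Diagonal pairs are a proportion 1/J of all pairs and contribute at most 1 each; off the diagonal
   the bound is [gamma]. *)
rewrite -(avg_diag R J0) -[gamma](avg_cst _ J0) -avgD; apply: le_avg => i iJ.
rewrite exchange_avg -[gamma](avg_cst _ J0) -avgD; apply: le_avg => j jJ.
(* Since [i' - j'] divides J!, the single step 2 D^2 J! serves all off-diagonal pairs. *)
have off i' j' : (j' < i')%N -> (i' < J)%N ->
    avg K (fun k => mean (fun x => u (k + i')%N x * u (k + j')%N x)) <= gamma.
  move=> ji iJ'.
  have /dvdnP[m mE] : (i' - j' %| J`!)%N.
    by rewrite dvdn_fact // subn_gt0 ji /= (leq_trans (leq_subr _ _)) // ltnW.
  have m0 : (m <= J`!)%N by rewrite mE leq_pmulr // subn_gt0.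
  apply: (le_trans (@mean_corr_squares D K L i' j' m h beta K0 L0 h1 beta0 ji _)).
    by rewrite [((i' - j') * m)%N]mulnC -mE.
  by rewrite lerD2l ler_wpM2r ?invr_ge0 ?ler0n // ler_wpM2l // ler_nat leq_mul2r m0 orbT.
have [ij|ji|<-] := ltngtP i j.
- rewrite add0r; apply: le_trans (off j i ij jJ).
  by rewrite le_eqVlt; apply/orP; left; apply/eqP; apply: eq_avg => k _; apply: eq_mean => x; rewrite mulrC.
- by rewrite add0r; exact: off.
- apply: (@le_trans _ _ 1); last by rewrite lerDl.
  rewrite -[leRHS](avg_cst _ K0); apply: le_avg => k _.
  rewrite -[leRHS](@mean_cst R G); apply: le_mean => x.
  by have := u1 (k + i)%N x; rewrite ler_norml => /andP[? ?]; nra.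
Qed.

End VanDerCorput.

(** * The increment of L2 energy in the absence of returns *)

Section EnergyIncrement.
Variables (R : realType) (G : finZmodType) (t : G) (A : {set G}).

Let f (x : G) : R := (x \in A)%:R.

(** Without returns [f] is orthogonal to its translates along the squares, whereas [g], its average,
    is nearly invariant under them. So [h = f - g] correlates negatively with [f] along squares, and
    van der Corput forces [P' h] to be large. As [P' g] is close to [g], this adds to the energy of
    [g]. *)
Lemma energy_increment (D J K L L' : nat) (delta : R) :
  let eta := delta ^+ 2 / 2 in let beta := eta ^+ 2 / 4 in
  (0 < D)%N -> (0 < J)%N -> (0 < K)%N -> (0 < L)%N -> (0 < L')%N -> 0 < delta ->
  delta <= mean f ->
  J%:R^-1 <= eta ^+ 2 / 16 ->
  4 * J%:R / K%:R <= eta ^+ 2 / 16 ->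
  4 * (J`! * L')%:R / K%:R <= eta ^+ 2 / 16 ->
  2 * (D * K ^ 2)%:R / L%:R <= eta ->
  4 * (2 * D * J`! * L')%:R / L%:R <= beta ^+ 2 / 12 ->
  (forall n x, (0 < n <= D * K)%N -> x \in A -> x + t *~ (n ^ 2)%N%:Z \notin A) ->
  mean (fun x => fejer t D%:Z L f x ^+ 2) + beta ^+ 2 / 2
  <= mean (fun x => fejer t (2 * D ^ 2 * J`!)%N%:Z L' f x ^+ 2).
Proof.
move=> eta beta D0 J0 K0 L0 L'0 d0 df hJ hK1 hK2 hL1 hL2 noret.
have eta0 : 0 < eta by rewrite divr_gt0 ?exprn_gt0.
have beta0 : 0 < beta by rewrite divr_gt0 ?exprn_gt0.
have f01 x : 0 <= f x <= 1 by rewrite /f; case: (x \in A); rewrite ?lexx ?ler01.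
have f1 x : `|f x| <= 1 by have := f01 x; rewrite ler_norml; lra.
pose g := fejer t D%:Z L f; pose h x := f x - g x.
have g01 x : 0 <= g x <= 1.
  apply/andP; split; last by have := norm_fejer t D%:Z L ler01 f1 x; rewrite ler_norml => /andP[].
  rewrite /g /fejer /apavg /avg.
  do 2!(rewrite divr_ge0 ?ler0n //; apply: sumr_ge0 => ? _).
  by rewrite /f ler0n.
have h1 x : `|h x| <= 1.
  by rewrite /h ler_norml; move: (f x) (g x) (f01 x) (g01 x) => a b /andP[? ?] /andP[? ?]; lra.
pose P' (u : G -> R) := fejer t (2 * D ^ 2 * J`!)%N%:Z L' u.
pose V x := avg K (fun k => h (x + t *~ ((D * k.+1) ^ 2)%N%:Z)).
(* The mean of [f * g] is at least [delta ^ 2 = 2 * eta], and one [eta] is lost to the drift of [g]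
   along the squares. *)
have corr : mean (fun x => f x * V x) <= - eta.
  have zero : mean (fun x => f x * avg K (fun k => f (x + t *~ ((D * k.+1) ^ 2)%N%:Z))) = 0.
    rewrite -[RHS](@mean_cst R G); apply: eq_mean => x.
    rewrite -avgZ -[RHS](avg_cst _ K0); apply: eq_avg => k kK.
    rewrite /f; case: (boolP (x \in A)) => xA; last by rewrite mul0r.
    rewrite (negPf (noret _ _ _ xA)) ?mulr0 //.
    by rewrite muln_gt0 D0 leq_mul2l kK orbT.
  have near : forall x, f x * g x - eta <= f x * avg K (fun k => g (x + t *~ ((D * k.+1) ^ 2)%N%:Z)).
    move=> x; have : `|avg K (fun k => g (x + t *~ ((D * k.+1) ^ 2)%N%:Z)) - g x| <= eta.
      rewrite -[g x](avg_cst _ K0) -avgB; apply: ler_norm_avg; first exact: ltW.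
      move=> k kK.
      have -> : ((D * k.+1) ^ 2)%N%:Z = D%:Z * (D * k.+1 ^ 2)%N%:Z.
        by rewrite -PoszM; congr Posz; rewrite expnMn mulnA mulnn.
      have := @apavg_translate R G t D%:Z L (apavg t (- D%:Z) L f) (D * k.+1 ^ 2) x (norm_apavg t (- D%:Z) L ler01 f1).
      move=> /le_trans; apply; apply: le_trans hL1.
      by rewrite ler_wpM2r ?invr_ge0 ?ler0n // ler_wpM2l // ler_nat leq_mul2l leq_sqr kK orbT.
    by have := f01 x; rewrite ler_norml => /andP[? ?] /andP[? ?]; nra.
  have := le_mean near; rewrite meanB mean_cst.
  have := mean_fejer_ge t D%:Z L0 (ltW d0) df.
  have -> : mean (fun x => f x * V x) =
      mean (fun x => f x * avg K (fun k => f (x + t *~ ((D * k.+1) ^ 2)%N%:Z)))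
      - mean (fun x => f x * avg K (fun k => g (x + t *~ ((D * k.+1) ^ 2)%N%:Z))).
    by rewrite -meanB; apply: eq_mean => x; rewrite -mulrBr -avgB.
  rewrite zero -/g /eta; lra.
have Vbig : eta ^+ 2 <= mean (fun x => V x ^+ 2).
  have pw x : - (2 * eta) * (f x * V x) <= eta ^+ 2 + V x ^+ 2.
    have : 0 <= (eta * f x + V x) ^+ 2 by exact: sqr_ge0.
    have : eta ^+ 2 * f x ^+ 2 <= eta ^+ 2.
      by rewrite ler_piMr ?sqr_ge0 // expr_le1 //; case/andP: (f01 x).
    nra.
  have := le_mean pw; rewrite meanD mean_cst meanZ; nra.
have P'h : beta ^+ 2 <= mean (fun x => P' h x ^+ 2).
  (* Otherwise the mean of [V ^ 2] is at most three terms [eta ^ 2 / 16] plus [beta = eta ^ 2 / 4],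
     less than [eta ^ 2]. *)
  rewrite leNgt; apply/negP => /ltW small.
  have := le_trans Vbig (@van_der_corput_squares R G t D J K L' h beta J0 K0 L'0 h1 beta0 small).
  have : 0 < eta ^+ 2 by exact: exprn_gt0.
  rewrite /beta; lra.
(* The error is paid six times, four in expanding the square of [P' f] and two through [cross], so
   half of [beta ^ 2] survives. *)
pose e := beta ^+ 2 / 12.
have e0 : 0 <= e by rewrite divr_ge0 ?sqr_ge0.
have P'g x : `|P' g x - g x| <= e.
  apply: le_trans hL2.
  have := @fejer_apavg_near R G t D%:Z (2 * D * J`!) L L' (apavg t (- D%:Z) L f) L'0 _ x.
  rewrite -PoszM (_ : (D * (2 * D * J`!) = 2 * D ^ 2 * J`!)%N); last nia.
  by apply; exact: norm_apavg.
have P'h1 x : `|P' h x| <= 1 by exact: norm_fejer.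
have P'E x : P' f x = P' g x + P' h x.
  by rewrite /P' /h fejerB addrC subrK.
(* By self-adjointness this is <P'g, h>, close to <g, h>, which is nonnegative by positivity of
   [fejer]. *)
have cross : - e <= mean (fun x => g x * P' h x).
  rewrite -[mean _](_ : mean (fun x => P' g x * h x) = _); last exact: fejer_adj.
  have pw x : g x * h x - e <= P' g x * h x.
    by have := P'g x; have := h1 x; rewrite !ler_norml => /andP[? ?] /andP[? ?]; nra.
  have := le_mean pw; rewrite meanB mean_cst.
  have := fejer_comp_ge0 t D%:Z f L0; rewrite -/g -/h; lra.
have pw x : g x ^+ 2 + 2 * (g x * P' h x) + P' h x ^+ 2 - 4 * e <= P' f x ^+ 2.
  rewrite P'E; have := P'g x; have := P'h1 x; have := g01 x.
  rewrite !ler_norml => /andP[? ?] /andP[? ?] /andP[? ?].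
  have : 0 <= (P' g x - g x) ^+ 2 by exact: sqr_ge0.
  nra.
have := le_mean pw; rewrite meanB !meanD meanZ mean_cst -/g -/P' -/(P' f).
have -> : beta ^+ 2 / 2 = beta ^+ 2 - 6 * e by rewrite /e; field.
move: cross P'h; move: (mean _) (mean _) (mean _) (mean _) => a b c d; lra.
Qed.

End EnergyIncrement.

(** * Recurrence along squares in finite abelian groups *)

Lemma exists_nat_ge (R : realType) (x : R) : exists2 n : nat, (0 < n)%N & x <= n%:R.
Proof.
exists (Num.bound `|x|).+1 => //; apply: (le_trans (ler_norm x)).
apply: (le_trans (ltW (archi_boundP (normr_ge0 x)))); by rewrite ler_nat.
Qed.

Section Recurrence.
Variable R : realType.

Definition returns (G : finZmodType) (t : G) (A : {set G}) (n : nat) : Prop :=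
  exists2 x, x \in A & x + t *~ (n ^ 2)%N%:Z \in A.

Lemma mean_indicator (G : finZmodType) (A : {set G}) :
  mean (fun x => (x \in A)%:R : R) = #|A|%:R / #|G|%:R.
Proof.
by rewrite /mean -natr_sum -sum1_card [in RHS]big_mkcond; congr (_%:R / _).
Qed.

(** Induction on [r] for all [D] at once: the energy at step [D] lies [kappa] below that at step 2
    D^2 J!, and no energy exceeds 1. [L] and [H] are chosen before the group, hence are uniform in
    it. *)
Lemma energy_bound (delta : R) : 0 < delta ->
  exists2 kappa : R, 0 < kappa & forall r D : nat, (0 < D)%N ->
  exists L H : nat, (0 < L)%N /\ forall (G : finZmodType) (t : G) (A : {set G}),
    delta <= mean (fun x => (x \in A)%:R : R) ->
    (forall n, (0 < n <= H)%N -> ~ returns t A n) ->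
    mean (fun x => fejer t D%:Z L (fun x => (x \in A)%:R : R) x ^+ 2) <= 1 - r%:R * kappa.
Proof.
move=> d0.
pose eta := delta ^+ 2 / 2; pose beta := eta ^+ 2 / 4.
have eta0 : 0 < eta by rewrite divr_gt0 ?exprn_gt0.
have beta0 : 0 < beta by rewrite divr_gt0 ?exprn_gt0.
have s0 : 0 < eta ^+ 2 / 16 by rewrite divr_gt0 ?exprn_gt0.
have [J J0 hJ] := exists_nat_ge (eta ^+ 2 / 16)^-1.
exists (beta ^+ 2 / 2); first by rewrite divr_gt0 ?exprn_gt0.
have ratio (x y : R) (m : nat) : (0 < m)%N -> 0 < y -> x / y <= m%:R -> x / m%:R <= y.
  by move=> m0 y0; rewrite ler_pdivrMr // ler_pdivrMr ?ltr0n // mulrC.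
elim=> [|r IH] D D0.
  exists 1%N, 0%N; split=> // G t A _ _; rewrite mul0r subr0.
  rewrite -[leRHS](@mean_cst R G); apply: le_mean => x.
  have A1 (y : G) : `|(y \in A)%:R : R| <= 1 by case: (y \in A); rewrite ?normr1 ?normr0 ?ler01.
  have := norm_fejer t D%:Z 1 ler01 A1 x.
  by move: (fejer _ _ _ _ _) => y; rewrite ler_norml => /andP[? ?]; nra.
have [|L' [H' [L'0 IHD]]] := IH (2 * D ^ 2 * J`!)%N.
  by rewrite muln_gt0 fact_gt0 muln_gt0 expn_gt0 D0.
(* Scales are chosen backwards: [K] long against [L'], then [L] long against both. *)
have [K K0 hK] := exists_nat_ge ((4 * J%:R + 4 * (J`! * L')%:R) / (eta ^+ 2 / 16)).
have [L L0 hL] := exists_nat_ge ((2 * (D * K ^ 2)%:R) / eta + 4 * (2 * D * J`! * L')%:R / (beta ^+ 2 / 12)).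
exists L, (maxn H' (D * K)); split=> // G t A dA noret.
have := IHD G t A dA; set E' := mean _ => hE'.
have {}hE' : E' <= 1 - r%:R * (beta ^+ 2 / 2).
  by apply: hE' => n /andP[n0 nH]; apply: noret; rewrite n0 leq_max nH.
suff : mean (fun x => fejer t D%:Z L (fun x => (x \in A)%:R : R) x ^+ 2) + beta ^+ 2 / 2 <= E'.
  move=> h; rewrite -natr1 mulrDl mul1r; move: h hE'; lra.
apply: (@energy_increment R G t A D J K L L' delta) => //.
- by rewrite invf_ple // posrE ?ltr0n.
- apply: ratio => //; apply: le_trans hK.
  by rewrite ler_wpM2r ?invr_ge0 ?(ltW s0) // lerDl mulr_ge0 ?ler0n.
- apply: ratio => //; apply: le_trans hK.
  by rewrite ler_wpM2r ?invr_ge0 ?(ltW s0) // lerDr mulr_ge0 ?ler0n.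
- apply: ratio => //; apply: le_trans hL.
  by rewrite lerDl !mulr_ge0 ?ler0n // invr_ge0 divr_ge0 // sqr_ge0.
- apply: ratio => //; first by rewrite divr_gt0 ?exprn_gt0.
  by apply: le_trans hL; rewrite lerDr !mulr_ge0 ?ler0n // invr_ge0 ltW.
- move=> n x /andP[n0 nH] xA; apply/negP => xA'.
  by apply: (noret n); [rewrite n0 leq_max nH orbT | exists x].
Qed.

Theorem square_recurrence (delta : R) : 0 < delta ->
  exists H : nat, forall (G : finZmodType) (t : G) (A : {set G}),
    delta * #|G|%:R <= #|A|%:R ->
    exists2 n, (0 < n <= H)%N & returns t A n.
Proof.
move=> d0; have [kappa k0 bound] := energy_bound d0.
(* This makes [1 - r * kappa] negative, which no mean of squares can be. *)
have [r r0 hr] := exists_nat_ge (2 / kappa).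
have [L [H [L0 hH]]] := bound r 1%N isT.
exists H => G t A dA.
have dA' : delta <= mean (fun x => (x \in A)%:R : R).
  by rewrite mean_indicator ler_pdivlMr // cardG_gt0.
apply: contrapT => no.
have := hH G t A dA' (fun n nH ret => no (ex_intro2 _ _ n nH ret)).
move=> /(le_trans _) le; have {le} : 0 <= 1 - r%:R * kappa.
  apply: le; rewrite -(@mean_cst R G 0); apply: le_mean => x; exact: sqr_ge0.
by move: hr; rewrite ler_pdivrMr //; lra.
Qed.

End Recurrence.

(** * Degrees in the square-difference graph *)

Definition square_adj (N : nat) (u v : 'I_N) : bool :=
  `[< nonzero_perfect_square (u%:Z - v%:Z) \/ nonzero_perfect_square (v%:Z - u%:Z) >].

Lemma square_adj_irr (N : nat) (u : 'I_N) : ~~ square_adj u u.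
Proof. by apply/asboolP; rewrite subrr; case=> [] [] /eqP. Qed.

Section Degree.
Variable N : nat.
Implicit Types (U : {set 'I_N}) (u v : 'I_N).

Lemma square_adj_add u v n : (0 < n)%N -> (v = u + n ^ 2 :> nat)%N -> square_adj u v.
Proof.
move=> n0 vE; apply/asboolP; right; rewrite vE PoszD addrC addKr; split.
  by rewrite eqz_nat -lt0n expn_gt0 n0.
by exists n%:Z; rewrite -mulnn PoszM expr2.
Qed.

(** In the cyclic group of order [2 * N] the sum [u + (q * n) ^ 2] does not wrap around, so a return
    for the generator [q ^ 2] is an equality of integers. *)
Lemma recurrence_below (R : realType) (delta : R) (H q : nat) U :
  (forall (G : finZmodType) (t : G) (A : {set G}),
    delta * #|G|%:R <= #|A|%:R -> exists2 n, (0 < n <= H)%N & returns t A n) ->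
  ((q * H) ^ 2 < N)%N -> delta * (2 * N)%:R <= #|U|%:R ->
  exists u v n, [/\ u \in U, v \in U, (0 < n <= H)%N & (v = u + (q * n) ^ 2 :> nat)%N].
Proof.
move=> rec qHN dU; have N0 : (0 < N)%N by exact: leq_ltn_trans qHN.
pose M := (2 * N).-1; have ME : M.+1 = (2 * N)%N by rewrite /M prednK // muln_gt0.
have lt2 (u : 'I_N) : (u < M.+1)%N by rewrite ME (leq_trans (ltn_ord u)) // leq_pmull.
pose iota (u : 'I_N) : 'I_M.+1 := Ordinal (lt2 u).
have iota_inj : injective iota by move=> u v /(congr1 val) /= /val_inj.
have [|n /andP[n0 nH] [x /imsetP[u uU ->] /imsetP[v vU]]] := rec 'I_M.+1 (inZp (q ^ 2)) (iota @: U).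
  by rewrite card_imset // card_ord ME.
have -> : (inZp (q ^ 2) : 'I_M.+1) *~ (n ^ 2)%N%:Z = inZp ((q * n) ^ 2).
  rewrite -pmulrn Zp_mulrn; apply: val_inj => /=.
  by rewrite modnMml expnMn.
move=> /(congr1 val) /= vE; exists u, v, n; split=> //; first by rewrite n0.
rewrite -vE modnDmr modn_small // ME mul2n -addnn.
have : ((q * n) ^ 2 <= (q * H) ^ 2)%N by rewrite leq_sqr leq_mul2l nH orbT.
by have := ltn_ord u; lia.
Qed.

(** Given [v], the pair of [u] and [k] determines [q]. Thus many steps [q] force many neighbours
    [u]. *)
Lemma card_steps (Q H : nat) (S : {set 'I_N}) v :
  (#|[set q : 'I_Q | [exists u in S, [exists k : 'I_H,
     (u == v + (q.+1 * k.+1) ^ 2 :> nat)%N]]]| <= #|S| * H)%N.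
Proof.
set B := [set q | _].
pose c (q : 'I_Q) (u : 'I_N) (k : 'I_H) := (u == v + (q.+1 * k.+1) ^ 2 :> nat)%N.
pose g (p : 'I_N * 'I_H) := [pick q : 'I_Q | c q p.1 p.2].
rewrite -(card_imset B (@Some_inj _)).
apply: (@leq_trans #|g @: finset.setX S (finset.setTfor 'I_H)|); last first.
  by apply: (leq_trans (leq_imset_card _ _)); rewrite cardsX cardsT card_ord.
apply/subset_leq_card/fintype.subsetP => o /imsetP[q qB ->]; move: qB.
rewrite inE => /existsP[u /andP[uS /existsP[k qE]]].
apply/imsetP; exists (u, k); first by rewrite !inE uS.
rewrite /g; case: pickP => [q' /eqP q'E|/(_ q)]; last by rewrite /c /= qE.
congr Some; apply: val_inj; apply/eqP; move: qE; rewrite q'E eqn_add2l.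
by rewrite eqn_sqr eqn_mul2r eqSS => /= /eqP ->.
Qed.

End Degree.

(** Double counting of pairs of a step and a vertex: for each of the [Q] steps at least half of [U]
    are lower ends of an edge, since the remaining vertices contain no return. If all degrees were
    below [d], a vertex would serve at most [H * d < Q / 2] steps. *)
Lemma large_degree (R : realType) (delta : R) : 0 < delta ->
  exists2 H : nat, (0 < H)%N & forall (N Q d : nat) (U : {set 'I_N}),
    ((Q * H) ^ 2 < N)%N -> (2 * (H * d) < Q)%N -> delta * N%:R <= #|U|%:R ->
    exists2 v, v \in U & (d <= #|[set u in U | square_adj v u]|)%N.
Proof.
move=> d0; have d40 : 0 < delta / 4 by rewrite divr_gt0.
(* In [delta / 4] one factor 2 pays for the modulus [2 * N], the other for passing to half of
   [U]. *)
have [H rec] := square_recurrence d40.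
exists H.+1 => // N Q d U QHN dQ dU.
have N0 : (0 < N)%N by exact: leq_ltn_trans QHN.
have U0 : (0 < #|U|)%N.
  by rewrite -(ltr0n R) (lt_le_trans _ dU) // mulr_gt0 ?ltr0n.
apply: contrapT => no.
have deg v : v \in U -> (#|[set u in U | square_adj v u]| < d)%N.
  by move=> vU; rewrite ltnNge; apply/negP => h; apply: no; exists v.
pose adj (q : 'I_Q) v (u : 'I_N) := [exists k : 'I_H, (u == v + (q.+1 * k.+1) ^ 2 :> nat)%N].
pose bad (q : 'I_Q) := [set v in U | [exists u in U, adj q v u]].
have badbig q : (#|U| <= 2 * #|bad q|)%N.
  rewrite leqNgt; apply/negP => small.
  have [||u [v [n [uU vU /andP[n0 nH] vE]]]] :=
      @recurrence_below N R (delta / 4) H q.+1 (U :\: bad q) rec.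
  - apply: leq_ltn_trans QHN; rewrite leq_sqr leq_mul //.
  - have : (#|U| <= 2 * #|U :\: bad q|)%N.
      have := cardsID (bad q) U; rewrite (finset.setIidPr _); last by apply/fintype.subsetP => v; rewrite inE => /andP[].
      by move: small; lia.
    rewrite -(ler_nat R) !natrM; move: dU; lra.
  move: uU vU; rewrite !inE => /andP[ub uU] /andP[_ vU].
  move: ub; rewrite uU /= => /negP; apply; apply/existsP; exists v; rewrite vU /=.
  have nH' : (n.-1 < H)%N by rewrite prednK.
  by apply/existsP; exists (Ordinal nH'); rewrite /= prednK // vE.
have : (Q * #|U| <= 2 * (\sum_(q : 'I_Q) #|bad q|))%N.
  rewrite big_distrr /= -{1}[Q]card_ord -sum_nat_const; exact: leq_sum.
have -> : (\sum_(q : 'I_Q) #|bad q| = \sum_(v in U) #|[set q : 'I_Q | [exists u in U, adj q v u]]|)%N.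
  rewrite (eq_bigr (fun q => \sum_(v in U) [exists u in U, adj q v u]))%N.
    rewrite exchange_big; apply: eq_bigr => v vU.
    by rewrite -sum1_card [RHS]big_mkcond; apply: eq_bigr => q _; rewrite inE.
  move=> q _; rewrite -sum1_card [LHS]big_mkcond [RHS]big_mkcond.
  by apply: eq_bigr => v _; rewrite inE; case: (v \in U).
have : (\sum_(v in U) #|[set q : 'I_Q | [exists u in U, adj q v u]]| <= \sum_(v in U) H * d)%N.
  apply: leq_sum => v vU.
  apply: (@leq_trans (#|[set u in U | square_adj v u]| * H)%N); last first.
    by rewrite mulnC leq_mul2l ltnW ?orbT ?deg.
  apply: leq_trans (@card_steps N Q H _ v); apply/subset_leq_card/fintype.subsetP => q.
  rewrite !inE => /existsP[u /andP[uU /existsP[k /eqP uE]]].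
  apply/existsP; exists u; rewrite inE uU /= (square_adj_add _ uE) /=.
    by apply/existsP; exists k; rewrite uE.
  by rewrite muln_gt0.
rewrite sum_nat_const; move: U0 dQ; set a := (\sum_(v in U) _)%N => *; nia.
Qed.

(** * Weighted counts of independent sets *)

Section IndependentSets.
Variables (R : realType) (V : finType) (e : rel V).
Implicit Types (U I : {set V}) (lam eps b : R).

Definition independent I : bool := [forall u in I, forall v in I, ~~ e u v].

Lemma independentP I : reflect {in I &, forall u v, ~~ e u v} (independent I).
Proof.
apply: (iffP forall_inP) => [h u v uI vI|h u uI]; first exact: (forall_inP (h u uI)).
by apply/forall_inP => v vI; exact: h.
Qed.

(** The partition function of the hard-core model at fugacity [lam] on the graph induced on [U]. *)
Definition indep_weight lam U : R :=
  \sum_(I : {set V} | (I \subset U) && independent I) lam ^+ #|I|.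

Lemma indep_weight_mono lam U1 U2 : 0 <= lam -> U1 \subset U2 ->
  indep_weight lam U1 <= indep_weight lam U2.
Proof.
move=> l0 s; rewrite /indep_weight [leLHS]big_mkcond [leRHS]big_mkcond.
apply: ler_sum => I _; case: ifP => [/andP[IU ->]|_]; last by case: ifP; rewrite // exprn_ge0.
by rewrite (fintype.subset_trans IU s).
Qed.

(** Independent sets containing [v] become, once [v] is deleted, independent sets avoiding its
    neighbours. *)
Lemma indep_weight_rec lam U v : 0 <= lam -> v \in U ->
  indep_weight lam U <= indep_weight lam (U :\ v)
    + lam * indep_weight lam ((U :\ v) :\: [set u in U | e v u]).
Proof.
move=> l0 vU; rewrite {1}/indep_weight (bigID (fun I => v \notin I)) /=.
apply: lerD.
  rewrite le_eqVlt; apply/orP; left; apply/eqP; apply: eq_bigl => I.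
  by rewrite subsetD1 andbAC.
rewrite (reindex_onto (fun I => v |: I) (fun I => I :\ v)) /=; last first.
  by move=> I /andP[_]; rewrite negbK => /finset.setD1K.
rewrite /indep_weight mulr_sumr [leLHS]big_mkcond [leRHS]big_mkcond.
apply: ler_sum => I _.
case: ifP => [/andP[/andP[/andP[sub ind] _] /eqP IE]|_]; last first.
  by case: ifP => // _; rewrite mulr_ge0 ?exprn_ge0.
have vI : v \notin I by rewrite -IE !inE eqxx.
move/independentP: ind => ind.
rewrite cardsU1 vI exprS ifT //; apply/andP; split.
  apply/fintype.subsetP => u uI; rewrite !inE.
  have uv : u \in v |: I by rewrite !inE uI orbT.
  rewrite (fintype.subsetP sub _ uv) /= andbT (ind v u) ?inE ?eqxx ?uI ?orbT //.
  by apply: contra vI => /eqP <-.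
by apply/independentP => x y xI yI; apply: ind; rewrite !inE ?xI ?yI orbT.
Qed.

Lemma indep_weight_le lam U : 0 <= lam -> indep_weight lam U <= (1 + lam) ^+ #|U|.
Proof.
move=> l0; have [n] := ubnP #|U|; elim: n U => // n IH U.
have [->|[v vU]] := set_0Vmem U.
  move=> _; rewrite cards0 expr0 /indep_weight (bigD1 finset.set0) /=; last first.
    by rewrite finset.sub0set; apply/independentP => u v; rewrite inE.
  rewrite cards0 expr0 big1 ?addr0 // => I /andP[/andP[]].
  by rewrite finset.subset0 => ->.
rewrite (cardsD1 v U) vU add1n ltnS => Un.
apply: (le_trans (indep_weight_rec l0 vU)); rewrite exprS mulrDl mul1r.
apply: lerD; first exact: IH.
rewrite ler_wpM2l //; apply: le_trans (IH _ Un); apply: indep_weight_mono => //.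
exact: finset.subsetDl.
Qed.

(* Kleitman-Winston: branching on a vertex v of degree >= d in U either drops v,
   or pays a factor lam and drops v together with its d neighbours. *)
Lemma indep_weight_bound lam eps b (d : nat) U : 0 <= lam -> 0 <= eps ->
  lam <= eps * (1 + eps) ^+ d -> irreflexive e ->
  (forall U', b <= #|U'|%:R -> exists2 v, v \in U' & (d <= #|[set u in U' | e v u]|)%N) ->
  indep_weight lam U <= expR (lam * b) * (1 + eps) ^+ #|U|.
Proof.
move=> l0 e0 le irr deg; have [n] := ubnP #|U|; elim: n U => // n IH U Un.
have e1 : 1 <= 1 + eps by rewrite lerDl.
(* Below the threshold [b] the trivial bound suffices, as [1 + lam <= expR lam]. *)
have [bU|Ub] := leP b #|U|%:R; last first.
  apply: (le_trans (indep_weight_le _ l0)); rewrite -[leLHS]mulr1.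
  apply: ler_pM; rewrite ?exprn_ge0 ?addr_ge0 //; last exact: exprn_ege1.
  apply: (@le_trans _ _ (expR lam ^+ #|U|)).
    by rewrite lerXn2r ?nnegrE ?addr_ge0 ?expR_ge0 //; exact: expR_ge1Dx.
  by rewrite -expRM_natr ler_expR ler_wpM2l // ltW.
have [v vU vd] := deg U bU; set N := [set u in U | e v u] in vd.
have vN : v \notin N by rewrite inE irr andbF.
have cU : #|U| = #|U :\ v|.+1 by rewrite (cardsD1 v U) vU.
have cN : (#|(U :\ v) :\: N| + d <= #|U :\ v|)%N.
  have NU : N \subset U :\ v.
    apply/fintype.subsetP => u uN; rewrite !inE; move: (uN); rewrite inE => /andP[-> _].
    by rewrite andbT; apply: contra vN => /eqP <-.
  by rewrite cardsD (finset.setIidPr NU); move: (subset_leq_card NU) vd; lia.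
have IH1 : indep_weight lam (U :\ v) <= expR (lam * b) * (1 + eps) ^+ #|U :\ v|.
  by apply: IH; rewrite -ltnS -cU.
have IH2 : indep_weight lam ((U :\ v) :\: N) <= expR (lam * b) * (1 + eps) ^+ #|(U :\ v) :\: N|.
  by apply: IH; rewrite -ltnS (leq_trans _ Un) // cU ltnS (leq_trans (leq_addr d _)).
apply: (le_trans (indep_weight_rec l0 vU)).
apply: (le_trans (lerD IH1 (ler_wpM2l l0 IH2))).
rewrite cU exprS mulrCA -mulrDr ler_wpM2l ?expR_ge0 // mulrDl mul1r lerD2l.
(* The branch through [v] loses [d] factors [1 + eps]; the hypothesis on [lam] bounds it by [eps]
   times the other branch's bound. *)
apply: (@le_trans _ _ (eps * (1 + eps) ^+ d * (1 + eps) ^+ #|(U :\ v) :\: N|)).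
  by rewrite ler_wpM2r ?exprn_ge0 // addr_ge0.
by rewrite -mulrA -exprD ler_wpM2l // ler_weXn2l // addnC.
Qed.

End IndependentSets.

(** * Binomial random subsets *)

Section BinomialWeights.
Variables (R : realType) (V : finType) (w : {set V} -> R) (p : R).
Hypotheses (w0 : forall S, 0 <= w S)
  (wp : forall J : {set V}, \sum_(S : {set V} | J \subset S) w S = p ^+ #|J|).
Implicit Types (S J : {set V}).
Local Notation n := (#|V|%:R : R).

Lemma sum_weights_mem J : \sum_S w S * (J \subset S)%:R = p ^+ #|J|.
Proof.
by rewrite -wp [RHS]big_mkcond; apply: eq_bigr => S _; case: ifP; rewrite ?mulr1 ?mulr0.
Qed.

Lemma sum_weights1 : \sum_S w S = 1.
Proof.
rewrite -[RHS](expr0 p) -(@cards0 V) -sum_weights_mem; apply: eq_bigr => S _.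
by rewrite finset.sub0set mulr1.
Qed.

Lemma card_sum_mem S : #|S|%:R = \sum_(x : V) (x \in S)%:R :> R.
Proof. by rewrite -natr_sum -sum1_card [in LHS]big_mkcond. Qed.

Lemma sum_weights_card : \sum_S w S * #|S|%:R = n * p.
Proof.
under eq_bigr do rewrite card_sum_mem mulr_sumr.
rewrite exchange_big /= mulr_natl -sumr_const; apply: eq_bigr => x _.
rewrite -[RHS]expr1 -(cards1 x) -sum_weights_mem; apply: eq_bigr => S _.
by rewrite finset.sub1set.
Qed.

(** The square counts ordered pairs: distinct ones weigh [p ^ 2], diagonal ones [p]. *)
Lemma sum_weights_card_sqr : 0 <= p -> \sum_S w S * #|S|%:R ^+ 2 <= n ^+ 2 * p ^+ 2 + n * p.
Proof.
move=> p0.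
have -> : \sum_S w S * #|S|%:R ^+ 2 = \sum_(x : V) \sum_(y : V) p ^+ #|[set x; y]|.
  under [RHS]eq_bigr do under eq_bigr do rewrite -sum_weights_mem.
  under [RHS]eq_bigr do rewrite exchange_big /=.
  rewrite [RHS]exchange_big /=; apply: eq_bigr => S _.
  under [RHS]eq_bigr do rewrite -mulr_sumr.
  rewrite -mulr_sumr; congr (_ * _); rewrite expr2 card_sum_mem mulr_suml.
  apply: eq_bigr => x _; rewrite mulr_sumr; apply: eq_bigr => y _.
  by rewrite finset.subUset !finset.sub1set -natrM mulnb.
have pw x y : p ^+ #|[set x; y]| <= p ^+ 2 + (y == x)%:R * p.
  rewrite cards2 eq_sym; case: (y == x); last by rewrite mul0r addr0.
  by rewrite mul1r expr1 lerDr sqr_ge0.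
apply: (@le_trans _ _ (\sum_(x : V) \sum_(y : V) (p ^+ 2 + (y == x)%:R * p))).
  by apply: ler_sum => x _; apply: ler_sum => y _; exact: pw.
rewrite le_eqVlt; apply/orP; left; apply/eqP.
rewrite (eq_bigr (fun=> n * p ^+ 2 + p)); last first.
  move=> x _; rewrite big_split /= sumr_const mulr_natl; congr (_ + _).
  rewrite -mulr_suml (bigD1 x) //= eqxx big1 ?addr0 ?mul1r // => y /negPf ->.
  by [].
rewrite sumr_const -[LHS]mulr_natl; ring.
Qed.

(** Chebyshev: the variance is at most [n * p] and the deviation exceeds half the mean. *)
Lemma weight_small_card : 0 < n * p ->
  \sum_(S : {set V} | #|S|%:R < n * p / 2) w S <= 4 / (n * p).
Proof.
move=> np0; set m := n * p.
have p0 : 0 <= p by move: np0; rewrite ltNge => /negP np; rewrite leNgt; apply/negP => p0; apply: np; rewrite nmulr_lle0.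
have m0 : 0 < m := np0.
have : (\sum_(S : {set V} | #|S|%:R < m / 2) w S) * (m / 2) ^+ 2 <= m.
  apply: (@le_trans _ _ (\sum_S w S * (#|S|%:R - m) ^+ 2)).
    rewrite mulr_suml big_mkcond; apply: ler_sum => S _; case: ifP => [lt|_].
      by rewrite ler_wpM2l //; nra.
    by rewrite mulr_ge0 ?sqr_ge0.
  rewrite (eq_bigr (fun S => w S * #|S|%:R ^+ 2 - 2 * m * (w S * #|S|%:R) + m ^+ 2 * w S)); last first.
    by move=> S _; ring.
  rewrite big_split sumrB /= -!mulr_sumr sum_weights1 sum_weights_card -/m.
  have := sum_weights_card_sqr p0; rewrite -exprMn -/m; lra.
set s := \sum_(S | _) _ => hs.
rewrite ler_pdivlMr // -(ler_pM2r m0); move: hs; lra.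
Qed.

Lemma weight_union (F : pred {set V}) :
  \sum_(S : {set V} | [exists I : {set V}, (I \subset S) && F I]) w S <= \sum_(I : {set V} | F I) p ^+ #|I|.
Proof.
under [leRHS]eq_bigr do rewrite -sum_weights_mem.
rewrite exchange_big /= big_mkcond; apply: ler_sum => S _.
rewrite -mulr_sumr; case: ifP => [/existsP[I /andP[IS FI]]|_]; last first.
  by rewrite mulr_ge0 ?sumr_ge0.
rewrite ler_peMr // (bigD1 I) //= IS lerDl sumr_ge0 //.
Qed.

(* Tilting the parameter from p to e p gains exp (- alpha p n / 2) on the sets
   of size at least alpha p n / 2, which beats both factors of
   [indep_weight_bound] taken with eps = alpha p / 8. *)
Lemma weight_dense_independent (e : rel V) (alpha : R) (d : nat) :
  0 < alpha -> 0 < n * p -> irreflexive e ->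
  64 * expR 1 <= alpha ^+ 2 * (p * d%:R) ->
  (forall U : {set V}, alpha / (8 * expR 1) * n <= #|U|%:R ->
     exists2 v, v \in U & (d <= #|[set u in U | e v u]|)%N) ->
  \sum_(S : {set V} | [exists A : {set V}, (A \subset S) && ((alpha * #|S|%:R <= #|A|%:R) && independent e A)]) w S
  <= (4 + 4 / alpha) / (n * p).
Proof.
move=> a0 np0 irr pd deg.
pose bad (S : {set V}) :=
  [exists A : {set V}, (A \subset S) && ((alpha * #|S|%:R <= #|A|%:R) && independent e A)].
have n0 : 0 < n.
  by rewrite lt_def ler0n andbT; apply: contraTneq np0 => ->; rewrite mul0r ltxx.
have p0 : 0 < p by rewrite -(pmulr_rgt0 _ n0).
have E0 : 0 < expR 1 :> R by exact: expR_gt0.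
(* For [S] of size at least [n * p / 2] the density condition implies this size bound, which is free
   of [S] and allows a union bound. *)
pose F (I : {set V}) := (alpha * (n * p / 2) <= #|I|%:R) && independent e I.
have split_bad : \sum_(S | bad S) w S <= \sum_(S : {set V} | #|S|%:R < n * p / 2) w S
    + \sum_(S : {set V} | [exists I : {set V}, (I \subset S) && F I]) w S.
  rewrite [leLHS]big_mkcond [X in _ <= X + _]big_mkcond [X in _ <= _ + X]big_mkcond -big_split /=.
  apply: ler_sum => S _; case: ifP => [/existsP[A /andP[AS /andP[aA indA]]]|_]; last first.
    by rewrite addr_ge0 //; case: ifP.
  have [lt|ge] := ltP #|S|%:R (n * p / 2); first by rewrite lerDl; case: ifP.
  rewrite add0r ifT //; apply/existsP; exists A; rewrite AS /F indA andbT.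
  by apply: le_trans aA; rewrite ler_pM2l.
apply: (le_trans split_bad); rewrite [_ / (n * p)]mulrDl; apply: lerD; first exact: weight_small_card.
apply: (le_trans (weight_union F)).
set lam := p * expR 1; have l0 : 0 <= lam by rewrite mulr_ge0 ?ltW.
set m := n * p; have m0 : 0 < m := np0.
have pw I : F I -> p ^+ #|I| <= expR (- (alpha * (m / 2))) * lam ^+ #|I|.
  move=> /andP[aI _].
  have -> : p ^+ #|I| = expR (- #|I|%:R) * lam ^+ #|I|.
    rewrite exprMn -expRM_natr mul1r mulrCA -expRD addNr expR0 mulr1 //.
  by rewrite ler_wpM2r ?exprn_ge0 // ler_expR lerN2.
apply: (le_trans (ler_sum _ pw)); rewrite -mulr_sumr.
have : \sum_(I : {set V} | F I) lam ^+ #|I| <= indep_weight e lam [set: V]%SET.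
  rewrite /indep_weight [leLHS]big_mkcond [leRHS]big_mkcond; apply: ler_sum => I _.
  rewrite finset.subsetT /=; case: ifP => [/andP[_ ->] //|_].
  by case: ifP; rewrite // exprn_ge0.
have e0 : 0 <= alpha / 8 * p by rewrite !mulr_ge0 ?ltW.
(* Bernoulli bounds the power below by [alpha / 8 * p * d]; the two factors 8 make up the 64 of the
   hypothesis. *)
have lame : lam <= alpha / 8 * p * (1 + alpha / 8 * p) ^+ d.
  have bern : 1 + alpha / 8 * p * d%:R <= (1 + alpha / 8 * p) ^+ d.
    elim: (d) => [|k IH]; first by rewrite mulr0 addr0 expr0.
    rewrite exprS -[k.+1%:R]natr1; set X := _ ^+ k in IH *.
    have k0 : 0 <= k%:R :> R by exact: ler0n.
    move: e0 IH k0; move: (alpha / 8 * p) (k%:R) X => y z X y0 IH z0.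
    have yz : 0 <= y * z by exact: mulr_ge0.
    have h : (1 + y) * (1 + y * z) <= (1 + y) * X by rewrite ler_wpM2l // addr_ge0.
    have : 0 <= y * (y * z) by exact: mulr_ge0.
    by move: h; lra.
  have a8 : 0 <= alpha / 8 by rewrite ltW // divr_gt0.
  have {}bern := ler_wpM2l a8 bern.
  rewrite mulrAC mulrC ler_pM2l //; apply: le_trans bern.
  by move: pd a8; lra.
have := @indep_weight_bound R V e lam (alpha / 8 * p) (alpha / (8 * expR 1) * n) d [set: V]%SET l0 e0 lame irr deg.
move=> h2 h1; have {h1 h2} h := le_trans h1 h2.
have h3 : (1 + alpha / 8 * p) ^+ #|[set: V]%SET| <= expR (alpha / 8 * m).
  rewrite cardsT [m]mulrC mulrA expRM_natr.
  by apply: lerXn2r; rewrite ?nnegrE ?addr_ge0 ?expR_ge0 //; exact: expR_ge1Dx.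
have {}h3 := ler_wpM2l (expR_ge0 (lam * (alpha / (8 * expR 1) * n))) h3.
have {h3}h := le_trans h h3.
have {}h := ler_wpM2l (expR_ge0 (- (alpha * (m / 2)))) h.
apply: (le_trans h); rewrite -!expRD.
(* The gain [alpha * m / 2] beats two losses of [alpha * m / 8]. What remains is bounded through
   exp(-x) <= 1/x. *)
have -> : - (alpha * (m / 2)) + (lam * (alpha / (8 * expR 1) * n) + alpha / 8 * m) = - (alpha * m / 4).
  by rewrite /lam /m; field; exact: lt0r_neq0.
have x0 : 0 < alpha * m / 4 by rewrite divr_gt0 ?mulr_gt0.
rewrite expRN (_ : 4 / alpha / m = (alpha * m / 4)^-1); last first.
  by field; rewrite !lt0r_neq0.
rewrite lef_pV2 ?posrE ?expR_gt0 //; apply: le_trans (expR_ge1Dx _); lra.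
Qed.

End BinomialWeights.

Local Open Scope classical_set_scope.
Local Open Scope ring_scope.

(** * The law of the random set *)

Section LawOfRandomSet.
Context (R : realType) (d : measure_display) (Omega : measurableType d)
  (P : probability Omega R) (T : finType) (p : R) (W : Omega -> {set T}).
Hypothesis WP : binomial_random_set P p W.
Implicit Types (S J : {set T}).

Definition law S : R := fine (P [set w | W w = S]).

Lemma measurable_law_event S : measurable [set w | W w = S].
Proof.
have [mW _ _] := WP.
have -> : [set w | W w = S] =
    \bigcap_(x in [set: T]) (if x \in S then mem_event W x else ~` mem_event W x).
  apply/seteqP; split=> [w /= WS x _|w h].
    by rewrite -WS; case: ifP => //= /negP.
  apply/finset.setP => x; have := h x I.
  by case: ifP => _ => [->//|/negP/negPf].
apply: fin_bigcap_measurable => [|x _]; first exact: finite_finset.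
by case: ifP => _; [exact: mW | apply: measurableC; exact: mW].
Qed.

(** The values of [W] cut the space into finitely many measurable atoms, so any property of [W] is
    an event. *)
Lemma probability_law (Phi : pred {set T}) :
  P [set w | Phi (W w)] = (\sum_(S : {set T} | Phi S) law S)%:E.
Proof.
have -> : [set w | Phi (W w)] = \bigcup_(S in [set` Phi]) [set w | W w = S].
  by apply/seteqP; split=> [w /= h|w [S /= PS ->] //]; exists (W w).
rewrite measure_fin_bigcup; last by move=> *; exact: measurable_law_event.
- rewrite -(bigfs _ (r := index_enum {set T})) ?index_enum_uniq //; last first.
    by move=> S _; rewrite mem_index_enum.
  by rewrite -sumEFin; apply: eq_bigr => S _; rewrite fineK // fin_num_measure //; exact: measurable_law_event.
- exact: finite_finpred.
- by move=> S1 S2 _ _ [w [/= <- <-]].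
Qed.

Lemma law_ge0 S : 0 <= law S.
Proof. by rewrite fine_ge0. Qed.

Lemma law_supset J : \sum_(S : {set T} | J \subset S) law S = p ^+ #|J|.
Proof.
have [_ pW indep] := WP; apply: EFin_inj; rewrite -(probability_law (fun S => J \subset S)).
have -> : [set w | J \subset W w] = \bigcap_(x in [set` J]) mem_event W x.
  by apply/seteqP; split=> [w /fintype.subsetP h x /= /h //|w h]; apply/fintype.subsetP => x /h.
by rewrite indep (eq_bigr (fun=> p%:E)) // prodEFin prodr_const.
Qed.

End LawOfRandomSet.

(** * Choice of parameters and conclusion *)

Lemma independent_square_adj (N : nat) (A : {set 'I_N}) :
  ~ has_square_difference A -> independent (@square_adj N) A.
Proof.
move=> no; apply/independentP => u v uA vA; apply/asboolP => -[sq|sq]; apply: no.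
  by exists u, v.
by exists v, u.
Qed.

Lemma powR_quarter_ge (R : realType) (X : R) :
  exists N0 : nat, forall N : nat, (N0 <= N)%N -> X <= N%:R `^ (1 / 4).
Proof.
have [N0 _ N0X] := exists_nat_ge (Num.max X 0 ^+ 4).
have X0 : 0 <= Num.max X 0 by rewrite le_max lexx orbT.
exists N0 => N N0N; apply: (@le_trans _ _ (Num.max X 0)); first by rewrite le_max lexx.
have -> : Num.max X 0 = (Num.max X 0 ^+ 4) `^ (1 / 4).
  by rewrite -powR_mulrn // -powRrM mulrCA mulfV // mulr1 powRr1.
apply: ge0_ler_powR; rewrite ?nnegrE ?divr_ge0 ?exprn_ge0 ?ler0n //.
by apply: (le_trans N0X); rewrite ler_nat.
Qed.

Lemma odd_multiple_le (a b : nat) :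
  (0 < b)%N -> ((2 * (a * b)).+1 * a <= 3 * a ^ 2 * b)%N.
Proof.
move=> b0; have h : (a * a <= a * a * b)%N by rewrite leq_pmulr.
nia.
Qed.

Theorem theorem1p2 (R : realType) (theta c alpha : R)
    (theta_gt0 : 0 < theta) (theta_lt : theta < 1 / 110)
    (c_gt0 : 0 < c) (alpha_gt0 : 0 < alpha) :
  exists o : nat -> R, o N @[N --> \oo] --> (0 : R) /\
    forall (N : nat) (p : R), (0 < N)%N ->
      c * N%:R `^ (- theta) < p -> p <= 1 ->
      forall (d : measure_display) (Omega : measurableType d)
             (P : probability Omega R) (W : Omega -> {set 'I_N}),
        binomial_random_set P p W ->
        ((1 - o N)%:E <= P [set w | relatively_sarkozy alpha (W w)])%E.
Proof.
have E0 : 0 < expR 1 :> R by exact: expR_gt0.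
have delta0 : 0 < alpha / (8 * expR 1) by rewrite divr_gt0 ?mulr_gt0.
have [H H0 deg] := large_degree delta0.
have HR0 : 0 < H%:R :> R by rewrite ltr0n.
(* The first term yields [s >= 2], hence [k > 0]; the second yields the degree condition [pk]. *)
pose X := 8 * H%:R ^+ 2 + 512 * expR 1 * H%:R ^+ 2 / (alpha ^+ 2 * c).
have Y0 : 0 <= 512 * expR 1 * H%:R ^+ 2 / (alpha ^+ 2 * c).
  by apply/ltW/divr_gt0; repeat apply: mulr_gt0 => //; exact: exprn_gt0.
have [N0 N0X] := powR_quarter_ge X.
pose K := (4 + 4 / alpha) / c.
have K0 : 0 < K by rewrite divr_gt0 // addr_gt0 // divr_gt0.
(* Below [N0] the error 1 makes the bound trivial. *)
exists (fun N => if (N0 <= N)%N then K / N%:R `^ (1 / 4) else 1); split.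
  apply/cvgrPdist_le => e e0; have [N1 N1K] := powR_quarter_ge (K / e).
  exists (maxn N0 N1) => // N /=; rewrite geq_max => /andP[N0N N1N].
  rewrite N0N sub0r normrN ger0_norm; last by rewrite divr_ge0 ?powR_ge0 // ltW.
  have Ke := N1K N N1N.
  have q0 : 0 < (N%:R : R) `^ (1 / 4) by apply: lt_le_trans Ke; rewrite divr_gt0.
  by rewrite ler_pdivrMr // mulrC -ler_pdivrMr.
move=> N p N_gt0 cp p1 d Omega P W WP.
case: ifP => [N0N|_]; last by rewrite subrr measure_ge0.
set q := (N%:R : R) `^ (1 / 4).
have qX : X <= q by exact: N0X.
have N1 : 1 <= N%:R :> R by rewrite ler1n.
have NR0 : 0 < N%:R :> R by exact: lt_le_trans N1.
have q1 : 1 <= q by rewrite -(powRr0 N%:R) ler_powR.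
have q0 : 0 < q by exact: lt_le_trans q1.
have nt0 : 0 < (N%:R : R) `^ (- theta) by exact: powR_gt0.
(* Since [theta < 1 / 110], the exponent [1 / 2 - theta] is at least 1/4. *)
have qs : q <= N%:R `^ (- theta) * Num.sqrt N%:R.
  rewrite -powR12_sqrt ?ler0n // -powRD; last by rewrite (lt0r_neq0 NR0) implybT.
  by rewrite ler_powR //; lra.
have qs' : q <= Num.sqrt N%:R.
  by rewrite -powR12_sqrt ?ler0n // ler_powR //; lra.
have p0 : 0 < p by apply: lt_trans cp; rewrite mulr_gt0.
have pN : c * q <= N%:R * p.
  apply: (@le_trans _ _ (N%:R * (c * N%:R `^ (- theta)))); last by rewrite ler_wpM2l ?ler0n // ltW.
  rewrite mulrCA ler_wpM2l ?(ltW c_gt0) //; apply: (le_trans qs).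
  rewrite mulrC ler_wpM2r ?(ltW nt0) //.
  rewrite -[leRHS]sqr_sqrtr ?ler0n // expr2 ler_peMl ?sqrtr_ge0 //.
  exact: le_trans qs'.
(* With degree [k <= s] and [Q = 2 * H * k + 1] steps, [Q * H <= 3 * H ^ 2 * k] is at most 3/4 of
   the square root of [N]. *)
pose s : R := Num.sqrt N%:R / (4 * H%:R ^+ 2).
pose k := Num.truncn s.
have s2 : 2 <= s.
  rewrite ler_pdivlMr ?mulr_gt0 ?exprn_gt0 //; apply: le_trans qs'; apply: le_trans qX.
  rewrite /X mulrA; have -> : 2 * 4 = 8 :> R by lra.
  by rewrite lerDl.
have s0 : 0 <= s by lra.
have /andP[ks sk] : k%:R <= s < k.+1%:R by rewrite truncn_itv.
have k0 : (0 < k)%N.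
  by rewrite -ltnS -(ltr_nat R); apply: le_lt_trans sk; apply: le_trans s2; rewrite ler_nat.
have k2 : s / 2 <= k%:R by move: sk; rewrite -[k.+1%:R]natr1; lra.
have QHN : (((2 * (H * k)).+1 * H) ^ 2 < N)%N.
  apply: (@leq_ltn_trans ((3 * H ^ 2 * k) ^ 2)).
    by rewrite leq_sqr odd_multiple_le.
  rewrite -(ltr_nat R) -[ltRHS]sqr_sqrtr ?ler0n // natrX ltr_pXn2r ?nnegrE ?ler0n ?sqrtr_ge0 //.
  rewrite natrM [(3 * H ^ 2)%:R]natrM natrX; move: ks; rewrite /s ler_pdivlMr ?mulr_gt0 ?exprn_gt0 //.
  have : 0 < H%:R ^+ 2 * k%:R :> R by rewrite mulr_gt0 ?exprn_gt0 // ltr0n.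
  lra.
have pk : 64 * expR 1 <= alpha ^+ 2 * (p * k%:R).
  apply: (@le_trans _ _ (alpha ^+ 2 * (c * N%:R `^ (- theta) * (s / 2)))); last first.
    by rewrite ler_wpM2l ?sqr_ge0 // ler_pM ?mulr_ge0 ?divr_ge0 // ltW // mulr_gt0.
  have -> : alpha ^+ 2 * (c * N%:R `^ (- theta) * (s / 2)) =
     (alpha ^+ 2 * c) * (N%:R `^ (- theta) * Num.sqrt N%:R) / (8 * H%:R ^+ 2).
    by rewrite /s; field; rewrite lt0r_neq0.
  rewrite ler_pdivlMr ?mulr_gt0 ?exprn_gt0 //.
  have ac0 : 0 < alpha ^+ 2 * c by rewrite mulr_gt0 ?exprn_gt0.
  rewrite -ler_pdivrMl //; apply: le_trans qs; apply: le_trans qX.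
  rewrite /X; set Y := (X in _ <= _ + X); have -> : (alpha ^+ 2 * c)^-1 * (64 * expR 1 * (8 * H%:R ^+ 2)) = Y.
    by rewrite /Y; field; rewrite !lt0r_neq0.
  by rewrite lerDr mulr_ge0 ?sqr_ge0.
have irr : irreflexive (@square_adj N) by move=> u; apply/negbTE/square_adj_irr.
have np0 : 0 < #|'I_N|%:R * p by rewrite card_ord mulr_gt0.
have := @weight_dense_independent R 'I_N (law P W) p (law_ge0 P W) (law_supset WP)
  (@square_adj N) alpha k alpha_gt0 np0 irr pk.
rewrite !card_ord; set bad := (X in X <= _) => /(_ _)/wrap[|badle].
  by move=> U hU; apply: (deg N (2 * (H * k)).+1 k U).
have {badle} badK : bad <= K / q.
  apply: (le_trans badle); rewrite /K -mulrA -invfM ler_pM2l ?addr_gt0 ?divr_gt0 //.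
  by rewrite lef_pV2 ?posrE ?mulr_gt0.
have -> : [set w | relatively_sarkozy alpha (W w)] =
    [set w | (fun S => `[< relatively_sarkozy alpha S >]) (W w)].
  by apply/seteqP; split=> w /= /asboolP.
rewrite (probability_law WP (fun S => `[< relatively_sarkozy alpha S >])) lee_fin.
have := sum_weights1 (law_supset WP).
rewrite (bigID (fun S => `[< relatively_sarkozy alpha S >])) /=.
set good := \sum_(S | _) _; set rest := \sum_(S | _) _ => tot.
suff : rest <= bad by lra.
rewrite /rest /bad [leLHS]big_mkcond [leRHS]big_mkcond; apply: ler_sum => S _.
case: ifP => [/asboolP nS|_]; last by case: ifP => // _; exact: law_ge0.
rewrite ifT //; apply: contrapT => nbad; apply: nS => A AS aA.
apply: contrapT => /independent_square_adj iA; apply: nbad.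
by apply/existsP; exists A; rewrite AS aA.
Qed.
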